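(* There exist a Banach space and a computability structure on it (in the sense of Pour-El and Richards) with uncountably many computable elements.
   Context: A computability structure on a Banach space $X$ over $\mathbb{C}$ is a nonempty set of sequences in $X$ (computable sequences) satisfying: (Linear forms) if $(x_n),(y_n)$ are computable, $(\alpha_{nk}),(\beta_{nk})$ computable double sequences of complex numbers and $d$ recursive, then $\bigl(\sum_{k=0}^{d(n)}(\alpha_{nk}x_k+\beta_{nk}y_k)\bigr)_n$ is computable; (Limits) if $(x_{nk})$ is a computable double sequence converging to $x_n$ as $k\to\infty$ effectively in $k$ and $n$, then $(x_n)$ is computable; (Norms) if $(x_n)$ is computable then $(\|x_n\|)$ is a computable sequence of reals. An element $x$ is computable if $(x,x,\dots)$ is a computable sequence. *)

(* Defs.v *)
From Stdlib Require Import Reals.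
From Stdlib Require Vector Cantor.
From Coquelicot Require Import Coquelicot.

Set Implicit Arguments.

Open Scope R_scope.

(* Total recursive functions of k arguments: Kleene's class, with minimization
   applied only where the minimum exists.  In [rec_prim] and [rec_min] the new
   function [h] is described by its defining equations. *)
Inductive recursive : forall k : nat, (Vector.t nat k -> nat) -> Prop :=
| rec_zero (k : nat) : recursive (fun _ : Vector.t nat k => 0%nat)
| rec_succ : recursive (fun v : Vector.t nat 1 => S (Vector.hd v))
| rec_proj (k : nat) (i : Fin.t k) :
    recursive (fun v : Vector.t nat k => Vector.nth v i)
| rec_comp (k m : nat) (f : Vector.t nat m -> nat)
    (g : Vector.t (Vector.t nat k -> nat) m) :
    recursive f ->
    (forall i : Fin.t m, recursive (Vector.nth g i)) ->
    recursive (fun v : Vector.t nat k => f (Vector.map (fun gi => gi v) g))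
| rec_prim (k : nat) (f : Vector.t nat k -> nat)
    (g : Vector.t nat (S (S k)) -> nat) (h : Vector.t nat (S k) -> nat) :
    recursive f ->
    recursive g ->
    (forall v, h (Vector.cons nat 0%nat k v) = f v) ->
    (forall y v, h (Vector.cons nat (S y) k v) =
       g (Vector.cons nat y (S k)
            (Vector.cons nat (h (Vector.cons nat y k v)) k v))) ->
    recursive h
| rec_min (k : nat) (f : Vector.t nat (S k) -> nat) (h : Vector.t nat k -> nat) :
    recursive f ->
    (forall v, f (Vector.cons nat (h v) k v) = 0%nat) ->
    (forall v y, (y < h v)%nat -> f (Vector.cons nat y k v) <> 0%nat) ->
    recursive h.

Definition recursive1 (d : nat -> nat) : Prop :=
  recursive (fun v : Vector.t nat 1 => d (Vector.hd v)).

Definition recursive2 (e : nat -> nat -> nat) : Prop :=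
  recursive (fun v : Vector.t nat 2 => e (Vector.hd v) (Vector.hd (Vector.tl v))).

Definition computable_rat_dseq (r : nat -> nat -> R) : Prop :=
  exists a b s : nat -> nat -> nat,
    recursive2 a /\ recursive2 b /\ recursive2 s /\
    forall n k : nat,
      b n k <> 0%nat /\ r n k = (-1) ^ s n k * (INR (a n k) / INR (b n k)).

Definition computable_real_seq (x : nat -> R) : Prop :=
  exists (r : nat -> nat -> R) (e : nat -> nat -> nat),
    computable_rat_dseq r /\ recursive2 e /\
    forall n N k : nat, (e n N <= k)%nat -> Rabs (r n k - x n) <= / 2 ^ N.

Definition computable_complex_seq (z : nat -> C) : Prop :=
  computable_real_seq (fun n => Re (z n)) /\
  computable_real_seq (fun n => Im (z n)).

(* A double sequence is read as a single one through the Cantor pairing. *)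
Definition flatten (T : Type) (x : nat -> nat -> T) : nat -> T :=
  fun m => let (n, k) := Cantor.of_nat m in x n k.

Definition computable_complex_dseq (z : nat -> nat -> C) : Prop :=
  computable_complex_seq (flatten z).

Definition converges_effectively (X : CompleteNormedModule C_AbsRing)
    (x : nat -> nat -> X) (y : nat -> X) : Prop :=
  exists e : nat -> nat -> nat,
    recursive2 e /\
    forall n N k : nat,
      (e n N <= k)%nat -> norm (minus (x n k) (y n)) <= / 2 ^ N.

(* [CS x] reads "the sequence x is computable"; [sum_n u d] is u 0 + ... + u d. *)
Record computability_structure (X : CompleteNormedModule C_AbsRing)
    (CS : (nat -> X) -> Prop) : Prop := {
  cs_nonempty : exists x : nat -> X, CS x;
  cs_linear_forms :
    forall (x y : nat -> X) (alpha beta : nat -> nat -> C) (d : nat -> nat),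
      CS x -> CS y ->
      computable_complex_dseq alpha -> computable_complex_dseq beta ->
      recursive1 d ->
      CS (fun n => sum_n (fun k => plus (scal (alpha n k : C_AbsRing) (x k))
                                        (scal (beta n k : C_AbsRing) (y k)))
                         (d n));
  cs_limits :
    forall (x : nat -> nat -> X) (y : nat -> X),
      CS (flatten x) -> converges_effectively X x y -> CS y;
  cs_norms :
    forall x : nat -> X, CS x -> computable_real_seq (fun n => norm (x n))
}.

Definition computable_element (X : CompleteNormedModule C_AbsRing)
    (CS : (nat -> X) -> Prop) (x : X) : Prop :=
  CS (fun _ => x).

Definition countable (T : Type) (A : T -> Prop) : Prop :=
  exists f : T -> nat, forall x y : T, A x -> A y -> f x = f y -> x = y.

(* Main.v *)
(** In the space of bounded complex functions on an uncountable set [I], with the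
    supremum norm, call a sequence computable if all its terms vanish off one
    finite set of indices and each of its coordinates is a computable sequence of
    complex numbers. Two such sequences live together on a finite set [L] of
    indices, so the axioms reduce to those of C^L with the maximum norm, whose
    values are computable. Every unit vector is computable, and there are
    uncountably many of them; nothing has to be uniform in [L]. *)

Require Import Defs.
From Stdlib Require Import Reals Lra Lia Arith List.
From Stdlib Require Import FunctionalExtensionality PropExtensionality.
From Stdlib Require Import ProofIrrelevance ClassicalEpsilon.
From Stdlib Require Vector Cantor.
From Coquelicot Require Import Coquelicot.

Set Implicit Arguments.
Open Scope R_scope.

(** * Bounded functions with the supremum norm *)

Section BoundedFunctions.

Variables (K : AbsRing) (I : Type) (V : NormedModule K).

(** The finite set L and the algorithms for the coordinates are only asserted to exist, separately
    for each sequence. This is how uncountably many elements can be computable although there are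
    only countably many programs. Limits keep their support because a double sequence, read through
    the pairing, is one sequence and so has one finite set for all its terms. What remains is
    effective arithmetic: products, sums of recursively varying length and effective limits, and for
    the norm a square root and a maximum. Recursive functions act on naturals only, so a real is
    carried as a difference of two natural numerators over a power of two, and each operation pays
    for its errors with extra bits of precision. *)

Definition bounded (f : I -> V) : Prop :=
  exists M : R, forall i, norm (f i) <= M.

Definition bfun : Type := {f : I -> V | bounded f}.

Definition bapp (f : bfun) (i : I) : V := proj1_sig f i.

(** The algebraic laws of the hierarchy are Leibniz equalities, so the boundedness proofs have to be
    identified as well. *)
Lemma bfun_ext (f g : bfun) : (forall i, bapp f i = bapp g i) -> f = g.
Proof.
  intros H; apply eq_sig_hprop; [intros; apply proof_irrelevance|].
  apply functional_extensionality; exact H.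
Qed.

Lemma bounded_zero : bounded (fun _ => zero).
Proof. exists 0; intros i; apply Req_le, norm_zero. Qed.

Lemma bounded_plus (f g : bfun) : bounded (fun i => plus (bapp f i) (bapp g i)).
Proof.
  destruct f as [f [M HM]], g as [g [N HN]]; exists (M + N); intros i; cbn.
  apply Rle_trans with (1 := norm_triangle _ _).
  now apply Rplus_le_compat.
Qed.

Lemma bounded_scal (a : K) (f : bfun) : bounded (fun i => scal a (bapp f i)).
Proof.
  destruct f as [f [M HM]]; exists (abs a * M); intros i; cbn.
  apply Rle_trans with (1 := norm_scal _ _).
  apply Rmult_le_compat_l; [apply abs_ge_0|apply HM].
Qed.

Lemma bounded_opp (f : bfun) : bounded (fun i => opp (bapp f i)).
Proof.
  destruct f as [f [M HM]]; exists M; intros i; cbn.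
  now rewrite norm_opp.
Qed.

Definition bzero : bfun := exist _ _ bounded_zero.
Definition bplus (f g : bfun) : bfun := exist _ _ (bounded_plus f g).
Definition bopp (f : bfun) : bfun := exist _ _ (bounded_opp f).
Definition bscal (a : K) (f : bfun) : bfun := exist _ _ (bounded_scal a f).

(* The value 0 is thrown in so that the supremum is also right for empty [I]. *)
Definition bnorm (f : bfun) : R :=
  real (Lub_Rbar (fun r => r = 0 \/ exists i, r = norm (bapp f i))).

Lemma bnorm_lub (f : bfun) :
  is_lub_Rbar (fun r => r = 0 \/ exists i, r = norm (bapp f i)) (bnorm f).
Proof.
  unfold bnorm.
  generalize (Lub_Rbar_correct (fun r => r = 0 \/ exists i, r = norm (bapp f i))).
  destruct (Lub_Rbar _) as [r| |]; intros H; [exact H| |].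
  (* Boundedness excludes the value [p_infty]; the element 0 of the set excludes [m_infty]. *)
  - destruct f as [f [M HM]].
    destruct (proj2 H (Rmax 0 M)).
    intros r [->|[i ->]]; cbn; [apply Rmax_l|].
    apply Rle_trans with (2 := Rmax_r _ _); apply HM.
  - destruct (proj1 H 0); now left.
Qed.

Lemma bnorm_ge_0 (f : bfun) : 0 <= bnorm f.
Proof. apply (proj1 (bnorm_lub f) 0); now left. Qed.

Lemma norm_bapp_le (f : bfun) (i : I) : norm (bapp f i) <= bnorm f.
Proof. apply (proj1 (bnorm_lub f)); right; now exists i. Qed.

Lemma bnorm_le (f : bfun) (M : R) :
  0 <= M -> (forall i, norm (bapp f i) <= M) -> bnorm f <= M.
Proof.
  intros H0 H; apply (proj2 (bnorm_lub f) M).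
  intros r [->|[i ->]]; cbn; auto.
Qed.

(** The mixins are transparent so that coordinates of sums, opposites and multiples reduce by
    conversion. *)
Definition bfun_AbelianMonoid_mixin : AbelianMonoid.mixin_of bfun.
Proof.
  apply (AbelianMonoid.Mixin bfun bplus bzero);
    intros; apply bfun_ext; intros i; cbn.
  - apply plus_comm.
  - apply plus_assoc.
  - apply plus_zero_r.
Defined.

Canonical bfun_AbelianMonoid :=
  AbelianMonoid.Pack bfun bfun_AbelianMonoid_mixin bfun.

Definition bfun_AbelianGroup_mixin : AbelianGroup.mixin_of bfun_AbelianMonoid.
Proof.
  apply (AbelianGroup.Mixin bfun_AbelianMonoid bopp).
  intros; apply bfun_ext; intros i; apply (plus_opp_r (bapp x i)).
Defined.

Canonical bfun_AbelianGroup :=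
  AbelianGroup.Pack bfun (AbelianGroup.Class _ _ bfun_AbelianGroup_mixin) bfun.

Definition bfun_ModuleSpace_mixin : ModuleSpace.mixin_of K bfun_AbelianGroup.
Proof.
  apply (ModuleSpace.Mixin K bfun_AbelianGroup bscal);
    intros; apply bfun_ext; intros i; cbn.
  - apply scal_assoc.
  - apply scal_one.
  - apply (scal_distr_l (V := NormedModule.ModuleSpace K V)).
  - apply (scal_distr_r (V := NormedModule.ModuleSpace K V)).
Defined.

Canonical bfun_ModuleSpace :=
  ModuleSpace.Pack K bfun (ModuleSpace.Class _ _ _ bfun_ModuleSpace_mixin) bfun.

(** With this order of the difference and a strict inequality, norm and balls are compatible by
    definition, with norm factor 1. *)
Definition bball (f : bfun) (e : R) (g : bfun) : Prop := bnorm (minus g f) < e.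

Lemma bnorm_minus_diag (f : bfun) : bnorm (minus f f) = 0.
Proof.
  rewrite minus_eq_zero.
  apply Rle_antisym; [|apply bnorm_ge_0].
  apply bnorm_le; [lra|]; intros i; apply Req_le, norm_zero.
Qed.

Lemma bnorm_plus (f g : bfun) : bnorm (plus f g) <= bnorm f + bnorm g.
Proof.
  apply bnorm_le.
  - apply Rplus_le_le_0_compat; apply bnorm_ge_0.
  - intros i; apply Rle_trans with (1 := norm_triangle _ _).
    apply Rplus_le_compat; apply norm_bapp_le.
Qed.

Lemma bnorm_opp_le (f : bfun) : bnorm (opp f) <= bnorm f.
Proof.
  apply bnorm_le; [apply bnorm_ge_0|]; intros i.
  change (norm (opp (bapp f i)) <= bnorm f); rewrite norm_opp.
  apply norm_bapp_le.
Qed.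

Definition bfun_UniformSpace_mixin : UniformSpace.mixin_of bfun.
Proof.
  apply (UniformSpace.Mixin bfun bzero bball); unfold bball.
  - intros x e; rewrite bnorm_minus_diag; apply cond_pos.
  - intros x y e H; apply Rle_lt_trans with (2 := H).
    rewrite <- opp_minus; apply bnorm_opp_le.
  - intros x y z e1 e2 H1 H2.
    rewrite (minus_trans y z x), (Rplus_comm e1).
    apply Rle_lt_trans with (1 := bnorm_plus _ _).
    now apply Rplus_lt_compat.
Defined.

Canonical bfun_UniformSpace :=
  UniformSpace.Pack bfun bfun_UniformSpace_mixin bfun.

Canonical bfun_NormedModuleAux :=
  NormedModuleAux.Pack K bfun
    (NormedModuleAux.Class _ _ (ModuleSpace.class _ bfun_ModuleSpace)
       bfun_UniformSpace_mixin) bfun.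

Definition bfun_NormedModule_mixin : NormedModule.mixin_of K bfun_NormedModuleAux.
Proof.
  apply (NormedModule.Mixin K bfun_NormedModuleAux bnorm 1).
  - exact bnorm_plus.
  - intros a f; apply bnorm_le.
    + apply Rmult_le_pos; [apply abs_ge_0|apply bnorm_ge_0].
    + intros i; apply Rle_trans with (1 := norm_scal _ _).
      apply Rmult_le_compat_l; [apply abs_ge_0|apply norm_bapp_le].
  - intros x y e H; exact H.
  - intros x y e H; rewrite Rmult_1_l; exact H.
  - intros f H; apply bfun_ext; intros i; apply norm_eq_zero.
    apply Rle_antisym; [rewrite <- H; apply norm_bapp_le|apply norm_ge_0].
Defined.

Canonical bfun_NormedModule :=
  NormedModule.Pack K bfun
    (NormedModule.Class _ _ _ bfun_NormedModule_mixin) bfun.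

Lemma bapp_sum_n (u : nat -> bfun) (n : nat) (i : I) :
  bapp (sum_n u n) i = sum_n (fun k => bapp (u k) i) n.
Proof.
  induction n as [|n IH]; [now rewrite !sum_O|].
  rewrite !sum_Sn, <- IH; reflexivity.
Qed.

End BoundedFunctions.

(** * Completeness of the space of bounded functions *)

Section BoundedFunctionsComplete.

Variables (K : AbsRing) (I : Type) (V : CompleteNormedModule K).

Let bfunV : Type := bfun I V.

(** The image filter on all functions [I -> V] converges uniformly, by completeness of that uniform
    space. Its limit is bounded, being uniformly close to some bounded function. The factor
    [norm_factor] enters because balls and norm of [V] are only comparable. *)
Lemma bfun_cauchy_lim (F : (bfunV -> Prop) -> Prop) :
  ProperFilter F -> cauchy F ->
  exists f : bfunV, forall e : posreal, F (ball f e).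
Proof.
  intros HF HC.
  set (G := filtermap (@bapp K I V) F : ((I -> V) -> Prop) -> Prop).
  assert (HG : ProperFilter G) by now apply filtermap_proper_filter.
  assert (Hlim : forall e : posreal, G (ball (lim_fct G) e)).
  { apply complete_cauchy_fct; [exact HG|].
    intros e; destruct (HC e) as [x Hx]; exists (bapp x).
    apply (filter_imp (F := F)) with (2 := Hx).
    intros y Hy i; apply (norm_compat1 (V := V)).
    apply Rle_lt_trans with (2 := Hy).
    apply (norm_bapp_le (minus y x) i). }
  set (g := lim_fct G) in Hlim.
  pose proof (norm_factor_gt_0 (V := V)) as Hnf.
  assert (Hn : forall e : posreal,
    F (fun f => forall i, norm (minus (bapp f i) (g i)) < norm_factor (V := V) * e)).
  { intros e; apply (filter_imp (F := F)) with (2 := Hlim e).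
    intros f Hf i; apply (norm_compat2 (V := V)); apply Hf. }
  assert (Hb : bounded V g).
  { destruct (filter_ex _ (Hn (mkposreal 1 Rlt_0_1))) as [f Hf]; cbn in Hf.
    exists (norm_factor (V := V) * 1 + bnorm f); intros i.
    replace (g i) with (plus (opp (minus (bapp f i) (g i))) (bapp f i)).
    - apply Rle_trans with (1 := norm_triangle _ _).
      apply Rplus_le_compat; [|apply norm_bapp_le].
      rewrite norm_opp; left; apply Hf.
    - rewrite opp_minus; unfold minus.
      now rewrite <- plus_assoc, plus_opp_l, plus_zero_r. }
  exists (exist _ g Hb); intros e.
  (* The strict pointwise bound becomes a weak one for the supremum; halving the radius restores
     strictness. *)
  assert (He : 0 < e / (2 * norm_factor (V := V))).
  { apply Rdiv_lt_0_compat; [apply cond_pos|lra]. }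
  apply (filter_imp (F := F)) with (2 := Hn (mkposreal _ He)).
  intros f Hf; change (bnorm (minus f (exist _ g Hb)) < e).
  pose proof (cond_pos e).
  apply Rle_lt_trans with (e / 2); [|lra].
  apply bnorm_le; [lra|]; intros i; left.
  replace (e / 2) with (norm_factor (V := V) * (e / (2 * norm_factor (V := V))))
    by (field; lra).
  apply Hf.
Qed.

(** The mixin asks for a limit operator defined on every family of sets, filter or not; hence the
    choice operator. *)
Definition bfun_lim (F : (bfunV -> Prop) -> Prop) : bfunV :=
  epsilon (inhabits (bzero I V)) (fun f => forall e : posreal, F (ball f e)).

Definition bfun_CompleteSpace_mixin : CompleteSpace.mixin_of (bfun_UniformSpace I V).
Proof.
  apply (CompleteSpace.Mixin (bfun_UniformSpace I V) bfun_lim).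
  - intros F HF HC; unfold bfun_lim; apply epsilon_spec.
    now apply bfun_cauchy_lim.
  - intros F1 F2 H12 H21.
    (* An arbitrary choice could separate equivalent filters, but filters finer than each other are
       equal as predicates. *)
    replace F2 with F1; [intros e; apply ball_center|].
    apply functional_extensionality; intros P.
    apply propositional_extensionality; split; [apply H21|apply H12].
Defined.

Canonical bfun_CompleteNormedModule :=
  CompleteNormedModule.Pack K bfunV
    (CompleteNormedModule.Class _ _
      (NormedModule.class _ (bfun_NormedModule I V)) bfun_CompleteSpace_mixin) bfunV.

End BoundedFunctionsComplete.

(** * Recursive functions *)

Lemma recursive_ext (k : nat) (f g : Vector.t nat k -> nat) :
  (forall v, f v = g v) -> recursive f -> recursive g.
Proof. intros H; now rewrite (functional_extensionality f g H). Qed.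

Definition recursive3 (f : nat -> nat -> nat -> nat) : Prop :=
  recursive (fun v : Vector.t nat 3 =>
    f (Vector.hd v) (Vector.hd (Vector.tl v)) (Vector.hd (Vector.tl (Vector.tl v)))).

(** The projections are restated through [Vector.hd] and [Vector.tl], the form that [recursive1],
    [recursive2] and [recursive3] unfold to. *)
Lemma recursive_arg0 (k : nat) :
  recursive (fun v : Vector.t nat (S k) => Vector.hd v).
Proof.
  apply recursive_ext with (2 := rec_proj (@Fin.F1 k)).
  intros v; now rewrite (Vector.eta v).
Qed.

Lemma recursive_arg1 (k : nat) :
  recursive (fun v : Vector.t nat (S (S k)) => Vector.hd (Vector.tl v)).
Proof.
  apply recursive_ext with (2 := rec_proj (Fin.FS (@Fin.F1 k))).
  intros v; rewrite (Vector.eta v), (Vector.eta (Vector.tl v)); reflexivity.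
Qed.

Lemma recursive_arg2 (k : nat) :
  recursive (fun v : Vector.t nat (S (S (S k))) =>
    Vector.hd (Vector.tl (Vector.tl v))).
Proof.
  apply recursive_ext with (2 := rec_proj (Fin.FS (Fin.FS (@Fin.F1 k)))).
  intros v; rewrite (Vector.eta v), (Vector.eta (Vector.tl v)),
    (Vector.eta (Vector.tl (Vector.tl v))); reflexivity.
Qed.

Lemma recursive_arg3 (k : nat) :
  recursive (fun v : Vector.t nat (S (S (S (S k)))) =>
    Vector.hd (Vector.tl (Vector.tl (Vector.tl v)))).
Proof.
  apply recursive_ext with (2 := rec_proj (Fin.FS (Fin.FS (Fin.FS (@Fin.F1 k))))).
  intros v; rewrite (Vector.eta v), (Vector.eta (Vector.tl v)),
    (Vector.eta (Vector.tl (Vector.tl v))),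
    (Vector.eta (Vector.tl (Vector.tl (Vector.tl v)))); reflexivity.
Qed.

Lemma recursive_comp1 (k : nat) (f : nat -> nat) (g : Vector.t nat k -> nat) :
  recursive1 f -> recursive g -> recursive (fun v => f (g v)).
Proof.
  intros Hf Hg.
  refine (rec_comp (Vector.cons _ g _ (Vector.nil _)) Hf _).
  intros i; apply (Fin.caseS' i); [exact Hg|apply Fin.case0].
Qed.

Lemma recursive_comp2 (k : nat) (f : nat -> nat -> nat)
    (g h : Vector.t nat k -> nat) :
  recursive2 f -> recursive g -> recursive h ->
  recursive (fun v => f (g v) (h v)).
Proof.
  intros Hf Hg Hh.
  refine (rec_comp (Vector.cons _ g _ (Vector.cons _ h _ (Vector.nil _))) Hf _).
  intros i; apply (Fin.caseS' i); [exact Hg|].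
  intros j; apply (Fin.caseS' j); [exact Hh|apply Fin.case0].
Qed.

Lemma recursive_S (k : nat) (g : Vector.t nat k -> nat) :
  recursive g -> recursive (fun v => S (g v)).
Proof. apply recursive_comp1, rec_succ. Qed.

Lemma recursive_const (k c : nat) : recursive (fun _ : Vector.t nat k => c).
Proof. induction c as [|c IH]; [apply rec_zero|exact (recursive_S IH)]. Qed.

Lemma recursive_prim1 (c : nat) (g : nat -> nat -> nat) (h : nat -> nat) :
  recursive2 g -> h 0%nat = c -> (forall y, h (S y) = g y (h y)) -> recursive1 h.
Proof.
  intros Hg H0 HS.
  apply (rec_prim (fun v : Vector.t nat 1 => h (Vector.hd v))
           (recursive_const 0 c) Hg); intros; [apply H0|apply HS].
Qed.

Lemma recursive_prim2 (f : nat -> nat) (g : nat -> nat -> nat -> nat)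
    (h : nat -> nat -> nat) :
  recursive1 f -> recursive3 g -> (forall a, h 0%nat a = f a) ->
  (forall y a, h (S y) a = g y (h y a) a) -> recursive2 h.
Proof.
  intros Hf Hg H0 HS.
  apply (rec_prim
    (fun v : Vector.t nat 2 => h (Vector.hd v) (Vector.hd (Vector.tl v))) Hf Hg);
    intros; [apply H0|apply HS].
Qed.

Lemma recursive_min1 (f : nat -> nat -> nat) (h : nat -> nat) :
  recursive2 f -> (forall a, f (h a) a = 0%nat) ->
  (forall a y, (y < h a)%nat -> f y a <> 0%nat) -> recursive1 h.
Proof.
  intros Hf H0 H1.
  apply (rec_min (fun v : Vector.t nat 1 => h (Vector.hd v)) Hf);
    intros; [apply H0|now apply H1].
Qed.

Lemma recursive_min2 (f : nat -> nat -> nat -> nat) (h : nat -> nat -> nat) :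
  recursive3 f -> (forall a b, f (h a b) a b = 0%nat) ->
  (forall a b y, (y < h a b)%nat -> f y a b <> 0%nat) -> recursive2 h.
Proof.
  intros Hf H0 H1.
  apply (rec_min
    (fun v : Vector.t nat 2 => h (Vector.hd v) (Vector.hd (Vector.tl v))) Hf);
    intros; [apply H0|now apply H1].
Qed.

Lemma recursive_add : recursive2 Nat.add.
Proof.
  apply recursive_prim2 with (f := fun a => a) (g := fun y r a => S r);
    [apply recursive_arg0|apply recursive_S, recursive_arg1|easy|easy].
Qed.

Lemma recursive_mul : recursive2 Nat.mul.
Proof.
  apply recursive_prim2 with (f := fun a => 0%nat) (g := fun y r a => (a + r)%nat);
    [exact (recursive_const 1 0)| |easy|easy].
  apply recursive_comp2 with (1 := recursive_add);
    [apply recursive_arg2|apply recursive_arg1].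
Qed.

Lemma recursive_pred : recursive1 Nat.pred.
Proof.
  apply recursive_prim1 with (c := 0%nat) (g := fun y r => y);
    [apply recursive_arg0|easy|easy].
Qed.

Lemma recursive_sub : recursive2 Nat.sub.
Proof.
  (* Primitive recursion runs on the first argument but subtraction recurses on the second, so the
     arguments are swapped. *)
  apply (recursive_comp2 (f := fun a b => (b - a)%nat));
    [|apply recursive_arg1|apply recursive_arg0].
  apply recursive_prim2 with (f := fun a => a) (g := fun y r a => Nat.pred r).
  - apply recursive_arg0.
  - apply recursive_comp1; [apply recursive_pred|apply recursive_arg1].
  - intros; lia.
  - intros; lia.
Qed.

(** The patterns [@?a v] recover arguments as functions of the vector. Any further function is found
    through a hypothesis of the context, which is why proofs first pose such facts and hide the
    functions behind local names. *)
Ltac recursive_tac :=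
  unfold recursive1, recursive2, recursive3; cbv beta;
  repeat match goal with
  | |- recursive (fun _ => ?c) => apply recursive_const
  | |- recursive (fun v => Vector.hd v) => apply recursive_arg0
  | |- recursive (fun v => Vector.hd (Vector.tl v)) => apply recursive_arg1
  | |- recursive (fun v => Vector.hd (Vector.tl (Vector.tl v))) =>
      apply recursive_arg2
  | |- recursive (fun v => Vector.hd (Vector.tl (Vector.tl (Vector.tl v)))) =>
      apply recursive_arg3
  | |- recursive (fun v => S (@?a v)) => apply (@recursive_S _ a)
  | |- recursive (fun v => Nat.add (@?a v) (@?b v)) =>
      apply (@recursive_comp2 _ Nat.add a b recursive_add)
  | |- recursive (fun v => Nat.mul (@?a v) (@?b v)) =>
      apply (@recursive_comp2 _ Nat.mul a b recursive_mul)
  | |- recursive (fun v => Nat.sub (@?a v) (@?b v)) =>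
      apply (@recursive_comp2 _ Nat.sub a b recursive_sub)
  | H : recursive1 ?f |- recursive (fun v => ?f (@?a v)) =>
      apply (@recursive_comp1 _ f a H)
  | H : recursive2 ?f |- recursive (fun v => ?f (@?a v) (@?b v)) =>
      apply (@recursive_comp2 _ f a b H)
  end.

Lemma recursive_max : recursive2 Nat.max.
Proof.
  apply recursive_ext with (f := fun v : Vector.t nat 2 =>
    (Vector.hd v + (Vector.hd (Vector.tl v) - Vector.hd v))%nat).
  - intros v; lia.
  - recursive_tac.
Qed.

Lemma recursive_pow2 : recursive1 (Nat.pow 2).
Proof.
  apply recursive_prim1 with (c := 1%nat) (g := fun y r => (r + r)%nat);
    [recursive_tac|easy|intros; cbn; lia].
Qed.

(** Reads off the sign of a rational, given as a power of -1. *)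
Lemma recursive_b2n_odd : recursive1 (fun s => Nat.b2n (Nat.odd s)).
Proof.
  apply recursive_prim1 with (c := 0%nat) (g := fun y r => (1 - r)%nat);
    [recursive_tac|easy|].
  intros y; rewrite Nat.odd_succ, <- Nat.negb_odd.
  now destruct (Nat.odd y).
Qed.

(** The quotient is the least y with a < (y + 1)(b + 1). Dividing by a successor guarantees that
    such a y exists. *)
Lemma recursive_div : recursive2 (fun a b => a / S b)%nat.
Proof.
  apply recursive_min2 with (f := fun y a b => (S a - S y * S b)%nat).
  - recursive_tac.
  - intros a b; cbv beta.
    pose proof (Nat.mul_succ_div_gt a (S b)); lia.
  - intros a b y Hy; pose proof (Nat.Div0.mul_div_le a (S b)); nia.
Qed.

Lemma recursive_sqrt : recursive1 Nat.sqrt.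
Proof.
  apply recursive_min1 with (f := fun y a => (S a - S y * S y)%nat).
  - recursive_tac.
  - intros a; pose proof (Nat.sqrt_spec a); lia.
  - intros a y Hy; pose proof (Nat.sqrt_spec a); nia.
Qed.

(** * The Cantor pairing and bounded sums *)

(** The number 0 + 1 + ... + n, spelled as inside [Cantor.to_nat] so that the formula for the
    pairing holds by conversion. *)
Definition triangular (n : nat) : nat :=
  nat_rec (fun _ => nat) 0%nat (fun i m => (S i + m)%nat) n.

Lemma recursive_triangular : recursive1 triangular.
Proof.
  apply recursive_prim1 with (c := 0%nat) (g := fun y r => (S y + r)%nat);
    [recursive_tac|easy|easy].
Qed.

Lemma triangular_le (m n : nat) :
  (m <= n)%nat -> (triangular m <= triangular n)%nat.
Proof.
  induction 1 as [|n Hn IH]; [easy|].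
  change (triangular (S n)) with (S n + triangular n)%nat; lia.
Qed.

Lemma cantor_to_nat (x y : nat) :
  Cantor.to_nat (x, y) = (y + triangular (y + x))%nat.
Proof. reflexivity. Qed.

Lemma recursive_cantor_to_nat : recursive2 (fun x y => Cantor.to_nat (x, y)).
Proof.
  pose proof recursive_triangular.
  apply recursive_ext with (f := fun v : Vector.t nat 2 =>
    (Vector.hd (Vector.tl v) +
     triangular (Vector.hd (Vector.tl v) + Vector.hd v))%nat); [easy|].
  recursive_tac.
Qed.

(** A code is m = y + T(x + y), with T the triangular numbers. As y <= x + y, the diagonal x + y is
    the least s with m < T(s + 1), and y = m - T(x + y). This sends the code of (n, k) to k, so that
    a sequence x_k can be read as a double one. *)
Lemma recursive_cantor_snd : recursive1 (fun m => snd (Cantor.of_nat m)).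
Proof.
  pose proof recursive_triangular as Htri.
  set (diag m := (fst (Cantor.of_nat m) + snd (Cantor.of_nat m))%nat).
  assert (Hto : forall m, m = (snd (Cantor.of_nat m) + triangular (diag m))%nat).
  { intros m; rewrite <- (Cantor.cancel_to_of m) at 1; unfold diag.
    destruct (Cantor.of_nat m) as [x y]; rewrite cantor_to_nat; cbn [fst snd].
    now rewrite (Nat.add_comm y x). }
  assert (Hdiag : recursive1 diag).
  { apply recursive_min1 with (f := fun s m => (S m - triangular (S s))%nat).
    - recursive_tac.
    - intros m; pose proof (Hto m).
      change (triangular (S (diag m))) with (S (diag m) + triangular (diag m))%nat.
      unfold diag at 1; lia.
    - intros m s Hs; pose proof (Hto m).
      pose proof (triangular_le Hs); lia. }
  apply recursive_ext with (f := fun v : Vector.t nat 1 =>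
    (Vector.hd v - triangular (diag (Vector.hd v)))%nat).
  - intros v; pose proof (Hto (Vector.hd v)); lia.
  - recursive_tac.
Qed.

(** The bound [d] comes first because [rec_prim] recurses on its first argument. The base case is
    the term at 0, so that d + 1 terms are added, as in [sum_n]. *)
Lemma recursive_sum (p : nat -> nat -> nat) :
  recursive2 p ->
  recursive3 (fun d n N =>
    nat_rec (fun _ => nat) (p (Cantor.to_nat (n, 0%nat)) N)
      (fun k s => (s + p (Cantor.to_nat (n, S k)) N)%nat) d).
Proof.
  intros Hp; pose proof recursive_cantor_to_nat as Hto.
  set (to := fun x y => Cantor.to_nat (x, y)) in Hto.
  apply (@rec_prim 2
    (fun v => p (to (Vector.hd v) 0%nat) (Vector.hd (Vector.tl v)))
    (fun v => Vector.hd (Vector.tl v) +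
      p (to (Vector.hd (Vector.tl (Vector.tl v))) (S (Vector.hd v)))
        (Vector.hd (Vector.tl (Vector.tl (Vector.tl v)))))%nat);
    [recursive_tac|recursive_tac|easy|easy].
Qed.

(** * Computable sequences of reals *)

Lemma INR_pow2 (N : nat) : INR (2 ^ N) = 2 ^ N.
Proof. now rewrite pow_INR. Qed.

Lemma pow2_pos (N : nat) : 0 < 2 ^ N.
Proof. apply pow_lt; lra. Qed.

Lemma INR_lt_pow2 (n : nat) : INR n < 2 ^ n.
Proof. rewrite <- INR_pow2; apply lt_INR, Nat.pow_gt_lin_r; lia. Qed.

Lemma INR_div_bounds (a b : nat) :
  b <> 0%nat -> INR (a / b) <= INR a / INR b < INR (a / b) + 1.
Proof.
  intros Hb; assert (H : 0 < INR b) by (apply lt_0_INR; lia).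
  split.
  - apply Rle_div_r; [easy|].
    rewrite <- mult_INR, Nat.mul_comm; apply le_INR, Nat.Div0.mul_div_le.
  - apply Rlt_div_l; [easy|].
    rewrite <- S_INR, <- mult_INR, Nat.mul_comm.
    apply lt_INR, Nat.mul_succ_div_gt; lia.
Qed.

(* The error bound is 2, not 1, because both numerators get rounded down when a
   rational approximation is brought to the denominator [2 ^ N]. *)
Definition dyadic_approx (x : nat -> R) (p q : nat -> nat -> nat) : Prop :=
  forall n N, Rabs (INR (p n N) - INR (q n N) - 2 ^ N * x n) <= 2.

(** The parity of the sign exponent sends the absolute value of the rational to [p] or to [q], the
    other one being 0; floor division then gives the denominator [2 ^ N]. *)
Lemma computable_dyadic_approx (x : nat -> R) :
  computable_real_seq x ->
  exists p q, recursive2 p /\ recursive2 q /\ dyadic_approx x p q.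
Proof.
  intros [r [e [[a [b [s [Ha [Hb [Hs Hr]]]]]] [He H]]]].
  pose proof recursive_b2n_odd as Hodd; pose proof recursive_pow2 as Hpow.
  pose proof recursive_div as Hdiv; pose proof recursive_pred as Hpred.
  set (odd s := Nat.b2n (Nat.odd s)) in *.
  set (pow2 := Nat.pow 2) in *.
  set (div x y := (x / S y)%nat) in *.
  exists (fun n N => div (pow2 N * (a n (e n N) * (1 - odd (s n (e n N)))))
                         (Nat.pred (b n (e n N))))%nat.
  exists (fun n N => div (pow2 N * (a n (e n N) * odd (s n (e n N))))
                         (Nat.pred (b n (e n N))))%nat.
  split; [recursive_tac|split; [recursive_tac|]].
  intros n N; specialize (H n N (e n N) (le_n _)).
  destruct (Hr n (e n N)) as [Hb0 Hrn]; rewrite Hrn in H; clear Hr Hrn.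
  set (k := e n N) in *; unfold div; rewrite Nat.succ_pred by exact Hb0.
  pose proof (INR_div_bounds (pow2 N * (a n k * (1 - odd (s n k)))) Hb0) as H1.
  pose proof (INR_div_bounds (pow2 N * (a n k * odd (s n k))) Hb0) as H2.
  revert H1 H2; rewrite !mult_INR, (INR_pow2 N : INR (pow2 N) = 2 ^ N).
  assert (Hb1 : 0 < INR (b n k)) by (apply lt_0_INR; lia).
  pose proof (pow2_pos N) as Hp2.
  set (A := INR (a n k)) in *; set (B := INR (b n k)) in *.
  set (u := INR (_ / _)); set (v := INR (_ / _)); intros H1 H2.
  (* The modulus [e] gives an error of at most 1 after scaling; the two rounding errors lie in [0,1)
     and enter with opposite signs. *)
  assert (H3 : Rabs (2 ^ N * ((-1) ^ s n k * (A / B)) - 2 ^ N * x n) <= 1).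
  { rewrite <- Rmult_minus_distr_l, Rabs_mult, (Rabs_pos_eq (2 ^ N)) by lra.
    rewrite <- (Rinv_r (2 ^ N)) by lra.
    apply Rmult_le_compat_l; [lra|exact H]. }
  assert (H4 : 2 ^ N * (A * INR (1 - odd (s n k))) / B
               - 2 ^ N * (A * INR (odd (s n k))) / B
               = 2 ^ N * ((-1) ^ s n k * (A / B))).
  { unfold odd; case_eq (Nat.odd (s n k)); intros Hodd'.
    - apply Nat.odd_spec in Hodd'; destruct Hodd' as [m ->].
      rewrite Nat.add_1_r, pow_1_odd; cbn; field; lra.
    - assert (Hev : Nat.even (s n k) = true)
        by (now rewrite <- Nat.negb_odd, Hodd').
      apply Nat.even_spec in Hev; destruct Hev as [m ->].
      rewrite pow_1_even; cbn; field; lra. }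
  apply Rabs_le_between in H3; apply Rabs_le_between; lra.
Qed.

(** The fraction at stage N is within 2^-N of its target, so the identity is a modulus of
    convergence. *)
Lemma computable_of_fractions (x : nat -> R) (p q b : nat -> nat -> nat) :
  recursive2 p -> recursive2 q -> recursive2 b ->
  (forall n N, b n N <> 0%nat) ->
  (forall n N, 2 ^ N * Rabs (INR (p n N) - INR (q n N) - INR (b n N) * x n)
               <= INR (b n N)) ->
  computable_real_seq x.
Proof.
  intros Hp Hq Hb Hb0 H.
  exists (fun n k => (INR (p n k) - INR (q n k)) / INR (b n k)), (fun n N => N).
  split; [|split; [recursive_tac|]].
  (* With truncated subtraction the numerator is |p - q|, and the sign exponent is 1 exactly when q
     > p. *)
  - exists (fun n k => (p n k - q n k) + (q n k - p n k))%nat, b,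
      (fun n k => 1 - (1 - (q n k - p n k)))%nat.
    split; [recursive_tac|split; [exact Hb|split; [recursive_tac|]]].
    intros n k; split; [apply Hb0|].
    assert (0 < INR (b n k)) by (apply lt_0_INR; specialize (Hb0 n k); lia).
    destruct (le_lt_dec (q n k) (p n k)) as [Hle|Hlt].
    + replace (q n k - p n k)%nat with 0%nat by lia.
      rewrite Nat.add_0_r, minus_INR by easy; cbn; field; lra.
    + replace (p n k - q n k)%nat with 0%nat by lia.
      replace (1 - (1 - (q n k - p n k)))%nat with 1%nat by lia.
      rewrite Nat.add_0_l, minus_INR by lia; cbn; field; lra.
  - intros n N k HNk.
    assert (Hb1 : 0 < INR (b n k)) by (apply lt_0_INR; specialize (Hb0 n k); lia).
    pose proof (pow2_pos k); pose proof (pow2_pos N).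
    apply Rle_trans with (/ 2 ^ k).
    + specialize (H n k).
      replace ((INR (p n k) - INR (q n k)) / INR (b n k) - x n)
        with ((INR (p n k) - INR (q n k) - INR (b n k) * x n) / INR (b n k))
        by (field; lra).
      rewrite Rabs_div, (Rabs_pos_eq (INR (b n k))) by lra.
      apply Rle_div_l; [easy|].
      apply Rmult_le_reg_l with (2 ^ k); [easy|].
      rewrite <- Rmult_assoc, Rinv_r by lra; lra.
    + apply Rinv_le_contravar; [easy|apply Rle_pow; [lra|exact HNk]].
Qed.

(** Here [m] counts guard bits: an error of [2 ^ m] in the numerator is harmless over the
    denominator [2 ^ (N + m)]. Products and sums need [m] to vary. *)
Lemma computable_of_dyadic (x : nat -> R) (p q m : nat -> nat -> nat) :
  recursive2 p -> recursive2 q -> recursive2 m ->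
  (forall n N, Rabs (INR (p n N) - INR (q n N) - 2 ^ (N + m n N) * x n)
               <= 2 ^ m n N) ->
  computable_real_seq x.
Proof.
  intros Hp Hq Hm H.
  pose proof recursive_pow2 as Hpow.
  set (pow2 := Nat.pow 2) in Hpow.
  apply computable_of_fractions with (p := p) (q := q)
    (b := fun n N => pow2 (N + m n N)%nat); [easy|easy|recursive_tac| |].
  - intros n N; apply Nat.pow_nonzero; lia.
  - intros n N; unfold pow2; rewrite INR_pow2.
    rewrite (pow_add 2 N) at 2.
    apply Rmult_le_compat_l; [apply Rlt_le, pow2_pos|apply H].
Qed.

Lemma computable_const (c : nat) : computable_real_seq (fun _ => INR c).
Proof.
  apply computable_of_fractions with (p := fun _ _ => c) (q := fun _ _ => 0%nat)
    (b := fun _ _ => 1%nat); try recursive_tac.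
  - easy.
  - intros n N; cbn [INR].
    replace (INR c - 0 - 1 * INR c) with 0 by ring; rewrite Rabs_R0; lra.
Qed.

Lemma computable_plus (x y : nat -> R) :
  computable_real_seq x -> computable_real_seq y ->
  computable_real_seq (fun n => x n + y n).
Proof.
  intros Hx Hy.
  destruct (computable_dyadic_approx Hx) as [p [q [Hp [Hq H]]]].
  destruct (computable_dyadic_approx Hy) as [p' [q' [Hp' [Hq' H']]]].
  (* Two errors of 2 add up to 2^2: two guard bits. *)
  apply computable_of_dyadic
    with (p := fun n N => (p n (N + 2) + p' n (N + 2))%nat)
         (q := fun n N => (q n (N + 2) + q' n (N + 2))%nat)
         (m := fun _ _ => 2%nat); try recursive_tac.
  intros n N; rewrite !plus_INR.
  specialize (H n (N + 2)%nat); specialize (H' n (N + 2)%nat).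
  apply Rabs_le_between in H; apply Rabs_le_between in H'.
  apply Rabs_le_between; lra.
Qed.

Lemma computable_opp (x : nat -> R) :
  computable_real_seq x -> computable_real_seq (fun n => - x n).
Proof.
  intros Hx; destruct (computable_dyadic_approx Hx) as [p [q [Hp [Hq H]]]].
  apply computable_of_dyadic with (p := fun n N => q n (N + 1)%nat)
    (q := fun n N => p n (N + 1)%nat) (m := fun _ _ => 1%nat); try recursive_tac.
  intros n N; specialize (H n (N + 1)%nat).
  apply Rabs_le_between in H; apply Rabs_le_between; lra.
Qed.

Lemma computable_minus (x y : nat -> R) :
  computable_real_seq x -> computable_real_seq y ->
  computable_real_seq (fun n => x n - y n).
Proof. intros Hx Hy; exact (computable_plus Hx (computable_opp Hy)). Qed.

Lemma computable_max (x y : nat -> R) :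
  computable_real_seq x -> computable_real_seq y ->
  computable_real_seq (fun n => Rmax (x n) (y n)).
Proof.
  intros Hx Hy; pose proof recursive_max as Hmax.
  destruct (computable_dyadic_approx Hx) as [p [q [Hp [Hq H]]]].
  destruct (computable_dyadic_approx Hy) as [p' [q' [Hp' [Hq' H']]]].
  (* Over the common subtrahend q + q', the maximum of p - q and p' - q' is max(p + q', p' + q) - (q
     + q'). A maximum does not enlarge the error 2, so one guard bit suffices. *)
  apply computable_of_dyadic
    with (p := fun n N => Nat.max (p n (N + 1) + q' n (N + 1))%nat
                                  (p' n (N + 1) + q n (N + 1))%nat)
         (q := fun n N => (q n (N + 1) + q' n (N + 1))%nat)
         (m := fun _ _ => 1%nat); try recursive_tac.
  intros n N; pose proof (pow2_pos (N + 1)) as H2.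
  rewrite <- RmaxRmult by lra.
  specialize (H n (N + 1)%nat); specialize (H' n (N + 1)%nat).
  apply Rabs_le_between in H; apply Rabs_le_between in H'.
  rewrite plus_INR; apply Rabs_le_between.
  destruct (Nat.max_spec (p n (N + 1) + q' n (N + 1))%nat
                         (p' n (N + 1) + q n (N + 1))%nat) as [[Hm ->]|[Hm ->]];
    [apply lt_INR in Hm|apply le_INR in Hm]; rewrite !plus_INR in *;
    unfold Rmax; destruct (Rle_dec _ _); lra.
Qed.

(** Precision 0 already yields a recursive bound for each term, which controls the error of a
    product. *)
Lemma dyadic_approx_bound (x : nat -> R) (p q : nat -> nat -> nat) (n : nat) :
  dyadic_approx x p q -> Rabs (x n) <= INR (p n 0%nat + q n 0%nat + 2).
Proof.
  intros H; specialize (H n 0%nat); rewrite !plus_INR; cbn in H |- *.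
  pose proof (pos_INR (p n 0%nat)); pose proof (pos_INR (q n 0%nat)).
  apply Rabs_le_between in H; apply Rabs_le_between; lra.
Qed.

Lemma computable_mult (x y : nat -> R) :
  computable_real_seq x -> computable_real_seq y ->
  computable_real_seq (fun n => x n * y n).
Proof.
  intros Hx Hy; pose proof recursive_pow2 as Hpow.
  destruct (computable_dyadic_approx Hx) as [p [q [Hp [Hq H]]]].
  destruct (computable_dyadic_approx Hy) as [p' [q' [Hp' [Hq' H']]]].
  (* Write P for 2^M. The numerators of the product have scale P^2 and error at most 4 + 2P|x| +
     2P|y| <= 2P(|x| + |y| + 2) <= 2^(T + 1 + M). Since M = N + T + 1, the scale N + (T + 1 + M) is
     indeed M + M. *)
  set (T n := ((p n 0 + q n 0 + 2) + (p' n 0 + q' n 0 + 2) + 2)%nat).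
  assert (HT : recursive1 T) by (unfold T; recursive_tac).
  set (M n N := (N + (T n + 1))%nat).
  assert (HM : recursive2 M) by (unfold M; recursive_tac).
  apply computable_of_dyadic
    with (p := fun n N => (p n (M n N) * p' n (M n N) + q n (M n N) * q' n (M n N))%nat)
         (q := fun n N => (p n (M n N) * q' n (M n N) + q n (M n N) * p' n (M n N))%nat)
         (m := fun n N => (T n + 1 + M n N)%nat); try recursive_tac.
  intros n N.
  pose proof (dyadic_approx_bound n H) as Bx.
  pose proof (dyadic_approx_bound n H') as By.
  specialize (H n (M n N)); specialize (H' n (M n N)).
  rewrite Nat.add_assoc; fold (M n N); rewrite !pow_add.
  pose proof (pow2_pos (M n N)) as HM0.
  assert (HM1 : 1 <= 2 ^ M n N) by (apply pow_R1_Rle; lra).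
  assert (Hsum : Rabs (x n) + Rabs (y n) + 2 <= 2 ^ T n).
  { left; apply Rle_lt_trans with (2 := INR_lt_pow2 (T n)).
    unfold T; rewrite (plus_INR _ 2), (plus_INR (_ + _ + 2)); cbn [INR]; lra. }
  rewrite !plus_INR, !mult_INR.
  set (P := 2 ^ M n N) in *.
  set (u := INR (p n (M n N)) - INR (q n (M n N))) in *.
  set (v := INR (p' n (M n N)) - INR (q' n (M n N))) in *.
  match goal with |- Rabs ?X <= _ =>
    replace X with ((u - P * x n) * (v - P * y n)
       + (u - P * x n) * (P * y n) + P * x n * (v - P * y n)) by (unfold u, v; ring)
  end.
  eapply Rle_trans; [apply Rabs_triang|].
  eapply Rle_trans; [apply Rplus_le_compat_r, Rabs_triang|].
  rewrite !Rabs_mult, (Rabs_pos_eq P) by lra.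
  pose proof (Rabs_pos (x n)); pose proof (Rabs_pos (y n)).
  pose proof (Rabs_pos (u - P * x n)); pose proof (Rabs_pos (v - P * y n)).
  assert (E1 : Rabs (u - P * x n) * Rabs (v - P * y n) <= 2 * 2)
    by (apply Rmult_le_compat; lra).
  assert (E2 : Rabs (u - P * x n) * (P * Rabs (y n)) <= 2 * (P * Rabs (y n)))
    by (apply Rmult_le_compat_r; [apply Rmult_le_pos; lra|easy]).
  assert (E3 : P * Rabs (x n) * Rabs (v - P * y n) <= P * Rabs (x n) * 2)
    by (apply Rmult_le_compat_l; [apply Rmult_le_pos; lra|easy]).
  apply Rle_trans with (P * (2 * (Rabs (x n) + Rabs (y n) + 2))); [lra|].
  rewrite (Rmult_comm _ P); apply Rmult_le_compat_l; lra.
Qed.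

(** An integer root taken at the doubled scale 2(N + 2) has scale N + 2. Let D be the numerator, A
    its integer root and t the scaled real root: A^2 - 2 <= t^2 < (A + 1)^2 + 2, so A and t differ
    by less than 4 = 2^2. *)
Lemma computable_sqrt (x : nat -> R) :
  (forall n, 0 <= x n) -> computable_real_seq x ->
  computable_real_seq (fun n => sqrt (x n)).
Proof.
  intros H0 Hx; pose proof recursive_sqrt as Hsqrt.
  destruct (computable_dyadic_approx Hx) as [p [q [Hp [Hq H]]]].
  apply computable_of_dyadic
    with (p := fun n N => Nat.sqrt (p n ((N + 2) + (N + 2)) - q n ((N + 2) + (N + 2)))%nat)
         (q := fun _ _ => 0%nat) (m := fun _ _ => 2%nat); try recursive_tac.
  intros n N; specialize (H n ((N + 2) + (N + 2))%nat); rewrite (pow_add 2) in H.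
  set (P := 2 ^ (N + 2)) in *; assert (HP : 0 < P) by apply pow2_pos.
  set (a := p n _) in *; set (b := q n _) in *.
  pose proof (sqrt_pos (x n)) as Hs0; pose proof (sqrt_sqrt _ (H0 n)) as Hs.
  set (s := sqrt (x n)) in *.
  (* Truncating a negative difference to 0 keeps the error bound because [x n] is nonnegative. *)
  assert (HD : Rabs (INR (a - b) - (P * s) * (P * s)) <= 2).
  { replace ((P * s) * (P * s)) with (P * P * x n) by (rewrite <- Hs; ring).
    specialize (H0 n).
    assert (0 <= P * P * x n) by (repeat apply Rmult_le_pos; lra).
    apply Rabs_le_between in H; apply Rabs_le_between.
    destruct (le_lt_dec b a) as [Hle|Hlt].
    - rewrite minus_INR by easy; lra.
    - replace (a - b)%nat with 0%nat by lia; apply lt_INR in Hlt; cbn; lra. }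
  destruct (Nat.sqrt_spec (a - b) (Nat.le_0_l _)) as [H1 H2].
  apply le_INR in H1; apply lt_INR in H2; rewrite mult_INR in H1, H2.
  rewrite S_INR in H2; pose proof (pos_INR (Nat.sqrt (a - b))) as HA.
  assert (0 <= P * s) by (apply Rmult_le_pos; lra).
  set (A := INR (Nat.sqrt (a - b))) in *; set (t := P * s) in *.
  apply Rabs_le_between in HD; apply Rabs_le_between; cbn; nra.
Qed.

Lemma computable_reindex (x : nat -> R) (g : nat -> nat) :
  recursive1 g -> computable_real_seq x ->
  computable_real_seq (fun n => x (g n)).
Proof.
  intros Hg Hx; destruct (computable_dyadic_approx Hx) as [p [q [Hp [Hq H]]]].
  apply computable_of_dyadic with (p := fun n N => p (g n) (N + 1)%nat)
    (q := fun n N => q (g n) (N + 1)%nat) (m := fun _ _ => 1%nat); try recursive_tac.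
  intros n N; rewrite pow_1; apply H.
Qed.

(** Each of the d + 1 terms contributes an error of at most 2, and 2(d + 1) <= 2^(d + 2); hence d +
    2 guard bits. *)
Lemma computable_sum (z : nat -> R) (d : nat -> nat) :
  recursive1 d -> computable_real_seq z ->
  computable_real_seq
    (fun n => sum_n (fun k => z (Cantor.to_nat (n, k))) (d n)).
Proof.
  intros Hd Hz; destruct (computable_dyadic_approx Hz) as [p [q [Hp [Hq H]]]].
  set (S_ (r : nat -> nat -> nat) (d n N : nat) :=
    nat_rec (fun _ => nat) (r (Cantor.to_nat (n, 0%nat)) N)
      (fun k s => (s + r (Cantor.to_nat (n, S k)) N)%nat) d).
  set (M n N := (N + (d n + 2))%nat).
  assert (HM : recursive2 M) by (unfold M; recursive_tac).
  assert (Hrec : forall r, recursive2 r ->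
    recursive2 (fun n N => S_ r (d n) n (M n N))).
  { intros r Hr.
    refine (rec_comp (Vector.cons _ (fun v => d (Vector.hd v)) _
      (Vector.cons _ (fun v => Vector.hd v) _ (Vector.cons _
        (fun v => M (Vector.hd v) (Vector.hd (Vector.tl v))) _ (Vector.nil _))))
      (recursive_sum Hr) _).
    intros i; apply (Fin.caseS' i); [cbn; recursive_tac|].
    intros j; apply (Fin.caseS' j); [cbn; recursive_tac|].
    intros l; apply (Fin.caseS' l); [cbn; recursive_tac|apply Fin.case0]. }
  apply computable_of_dyadic with (p := fun n N => S_ p (d n) n (M n N))
    (q := fun n N => S_ q (d n) n (M n N)) (m := fun n N => (d n + 2)%nat);
    [now apply Hrec|now apply Hrec|recursive_tac|].
  intros n N; fold (M n N).
  apply Rle_trans with (2 * INR (S (d n))).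
  (* The [d n] hidden in [M] is not generalized: the precision stays fixed while the number of terms
     grows. *)
  - induction (d n) as [|k IH].
    + rewrite sum_O; eapply Rle_trans; [apply H|cbn; lra].
    + rewrite sum_Sn; change (S_ p (S k) n (M n N))
        with (S_ p k n (M n N) + p (Cantor.to_nat (n, S k)) (M n N))%nat.
      change (S_ q (S k) n (M n N))
        with (S_ q k n (M n N) + q (Cantor.to_nat (n, S k)) (M n N))%nat.
      specialize (H (Cantor.to_nat (n, S k)) (M n N)).
      rewrite !plus_INR, S_INR; change plus with Rplus.
      apply Rabs_le_between in H; apply Rabs_le_between in IH.
      apply Rabs_le_between; lra.
  - pose proof (INR_lt_pow2 (S (d n))) as HS.
    replace (d n + 2)%nat with (S (S (d n))) by lia.
    change (2 ^ S (S (d n))) with (2 * 2 ^ S (d n)); lra.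
Qed.

(** At scale 2^(N + 2), stopping at stage [e n (N + 1)] costs 2 and approximating that term costs
    another 2, together 2^2. *)
Lemma computable_limit (z : nat -> R) (y : nat -> R) (e : nat -> nat -> nat) :
  recursive2 e -> computable_real_seq z ->
  (forall n N k, (e n N <= k)%nat ->
     Rabs (z (Cantor.to_nat (n, k)) - y n) <= / 2 ^ N) ->
  computable_real_seq y.
Proof.
  intros He Hz Hlim; pose proof recursive_cantor_to_nat as Hto.
  destruct (computable_dyadic_approx Hz) as [p [q [Hp [Hq H]]]].
  set (to x y := Cantor.to_nat (x, y)) in Hto.
  apply computable_of_dyadic
    with (p := fun n N => p (to n (e n (N + 1)%nat)) (N + 2)%nat)
         (q := fun n N => q (to n (e n (N + 1)%nat)) (N + 2)%nat)
         (m := fun _ _ => 2%nat); try recursive_tac.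
  intros n N.
  specialize (H (to n (e n (N + 1)%nat)) (N + 2)%nat).
  specialize (Hlim n (N + 1)%nat _ (le_n _)); fold (to n (e n (N + 1)%nat)) in Hlim.
  apply Rmult_le_compat_l with (r := 2 ^ (N + 2)) in Hlim;
    [|apply Rlt_le, pow2_pos].
  rewrite <- (Rabs_pos_eq (2 ^ (N + 2))) in Hlim at 1 by apply Rlt_le, pow2_pos.
  rewrite <- Rabs_mult in Hlim.
  replace (2 ^ (N + 2) * / 2 ^ (N + 1)) with 2 in Hlim.
  - apply Rabs_le_between in H; apply Rabs_le_between in Hlim.
    apply Rabs_le_between; lra.
  - replace (N + 2)%nat with (S (N + 1)) by lia.
    pose proof (pow2_pos (N + 1)); cbn [pow]; field; lra.
Qed.

(** * Computable sequences of complex numbers *)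

Lemma Re_sum_n (u : nat -> C) (n : nat) :
  Re (sum_n u n) = sum_n (fun k => Re (u k)) n.
Proof.
  induction n as [|n IH]; [now rewrite !sum_O|].
  rewrite !sum_Sn, <- IH; reflexivity.
Qed.

Lemma Im_sum_n (u : nat -> C) (n : nat) :
  Im (sum_n u n) = sum_n (fun k => Im (u k)) n.
Proof.
  induction n as [|n IH]; [now rewrite !sum_O|].
  rewrite !sum_Sn, <- IH; reflexivity.
Qed.

Lemma computable_real_seq_ext (x y : nat -> R) :
  (forall n, x n = y n) -> computable_real_seq x -> computable_real_seq y.
Proof. intros H; now rewrite (functional_extensionality x y H). Qed.

Lemma computable_complex_plus (z w : nat -> C) :
  computable_complex_seq z -> computable_complex_seq w ->
  computable_complex_seq (fun n => (z n + w n)%C).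
Proof.
  intros [Hz Hz'] [Hw Hw']; split;
    [exact (computable_plus Hz Hw)|exact (computable_plus Hz' Hw')].
Qed.

Lemma computable_complex_mult (z w : nat -> C) :
  computable_complex_seq z -> computable_complex_seq w ->
  computable_complex_seq (fun n => (z n * w n)%C).
Proof.
  intros [Hz Hz'] [Hw Hw']; split.
  - exact (computable_minus (computable_mult Hz Hw) (computable_mult Hz' Hw')).
  - exact (computable_plus (computable_mult Hz Hw') (computable_mult Hz' Hw)).
Qed.

Lemma computable_complex_reindex (z : nat -> C) (g : nat -> nat) :
  recursive1 g -> computable_complex_seq z ->
  computable_complex_seq (fun n => z (g n)).
Proof.
  intros Hg [Hz Hz']; split;
    [exact (computable_reindex Hg Hz)|exact (computable_reindex Hg Hz')].
Qed.

Lemma computable_complex_sum (z : nat -> C) (d : nat -> nat) :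
  recursive1 d -> computable_complex_seq z ->
  computable_complex_seq
    (fun n => sum_n (fun k => z (Cantor.to_nat (n, k))) (d n)).
Proof.
  intros Hd [Hz Hz']; split.
  - apply computable_real_seq_ext with (2 := computable_sum Hd Hz).
    intros n; symmetry; apply Re_sum_n.
  - apply computable_real_seq_ext with (2 := computable_sum Hd Hz').
    intros n; symmetry; apply Im_sum_n.
Qed.

Lemma flatten_to_nat (T : Type) (x : nat -> nat -> T) (n k : nat) :
  flatten x (Cantor.to_nat (n, k)) = x n k.
Proof. unfold flatten; now rewrite Cantor.cancel_of_to. Qed.

Lemma computable_complex_const (c : nat) :
  computable_complex_seq (fun _ => RtoC (INR c)).
Proof. split; [exact (computable_const c)|exact (computable_const 0)]. Qed.

Lemma computable_Cmod (z : nat -> C) :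
  computable_complex_seq z -> computable_real_seq (fun n => Cmod (z n)).
Proof.
  intros [Hz Hz'].
  apply computable_real_seq_ext
    with (x := fun n => sqrt (Re (z n) * Re (z n) + Im (z n) * Im (z n))).
  - intros n; unfold Cmod, Re, Im; apply f_equal; ring.
  - apply computable_sqrt; [intros n; nra|].
    exact (computable_plus (computable_mult Hz Hz) (computable_mult Hz' Hz')).
Qed.

(** * Finitely supported computable sequences *)

Section FinitelySupported.

Variable I : Type.

Definition bfunC : CompleteNormedModule C_AbsRing :=
  bfun_CompleteNormedModule I C_CompleteNormedModule.

Definition value (x : bfunC) (i : I) : C := bapp x i.

Lemma Cmod_value_le (x : bfunC) (i : I) : Cmod (value x i) <= norm x.
Proof. exact (norm_bapp_le x i). Qed.

Lemma norm_le_Cmod_value (x : bfunC) (M : R) :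
  0 <= M -> (forall i, Cmod (value x i) <= M) -> norm x <= M.
Proof. exact (@bnorm_le _ _ _ x M). Qed.

Lemma value_minus (x y : bfunC) (i : I) :
  value (minus x y) i = (value x i - value y i)%C.
Proof. reflexivity. Qed.

Lemma value_linear_form (x y : nat -> bfunC) (a b : nat -> C) (n : nat) (i : I) :
  value (sum_n (fun k => plus (scal (a k : C_AbsRing) (x k))
                              (scal (b k : C_AbsRing) (y k))) n) i
  = sum_n (fun k => a k * value (x k) i + b k * value (y k) i)%C n.
Proof. exact (bapp_sum_n _ n i). Qed.

Definition fs_computable (x : nat -> bfunC) : Prop :=
  exists l : list I,
    (forall n i, ~ In i l -> value (x n) i = 0%C) /\
    (forall i, computable_complex_seq (fun n => value (x n) i)).

(** Turns a supremum over all of [I] into an iterated maximum, to which [computable_max] applies by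
    induction on [l]. The start value 0 accounts for the indices off [l]. *)
Lemma norm_finite_support (x : bfunC) (l : list I) :
  (forall i, ~ In i l -> value x i = 0%C) ->
  norm x = fold_right (fun i r => Rmax (Cmod (value x i)) r) 0 l.
Proof.
  intros H.
  assert (H0 : forall l', 0 <= fold_right (fun i r => Rmax (Cmod (value x i)) r) 0 l').
  { induction l' as [|i l' IH]; cbn; [lra|].
    apply Rle_trans with (1 := IH); apply Rmax_r. }
  apply Rle_antisym.
  - apply norm_le_Cmod_value; [apply H0|]; intros i.
    destruct (excluded_middle_informative (In i l)) as [Hi|Hi].
    + clear H; induction l as [|j l IH]; [easy|]; cbn.
      destruct Hi as [->|Hi]; [apply Rmax_l|].
      apply Rle_trans with (1 := IH Hi); apply Rmax_r.
    + rewrite (H i Hi), Cmod_0; apply H0.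
  - clear H; induction l as [|i l IH]; [apply (norm_ge_0 (V := bfunC))|].
    apply Rmax_lub; [apply Cmod_value_le|exact IH].
Qed.

Lemma fs_computable_structure : computability_structure bfunC fs_computable.
Proof.
  split.
  - exists (fun _ => zero), nil; split; [reflexivity|].
    intros i; exact (computable_complex_const 0).
  - intros x y alpha beta d [l [Hl Hx]] [l' [Hl' Hy]] Ha Hb Hd.
    exists (l ++ l'); split.
    + intros n i Hi; rewrite value_linear_form.
      rewrite in_app_iff in Hi.
      rewrite sum_n_ext with (b := fun _ => zero); [exact (sum_n_m_const_zero 0 (d n))|].
      intros k; rewrite Hl, Hl' by tauto.
      now rewrite !Cmult_0_r, Cplus_0_r.
    + intros i.
      (* The summand at the code of (n, k) takes its coefficient from the flattened double sequence
         and its vector from the second component k. *)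
      pose proof (computable_complex_sum Hd (computable_complex_plus
        (computable_complex_mult Ha
          (computable_complex_reindex recursive_cantor_snd (Hx i)))
        (computable_complex_mult Hb
          (computable_complex_reindex recursive_cantor_snd (Hy i))))) as H.
      match type of H with computable_complex_seq ?f =>
        replace (fun n => value _ i) with f; [exact H|] end.
      apply functional_extensionality; intros n.
      rewrite value_linear_form; apply sum_n_ext; intros k.
      now rewrite !flatten_to_nat, Cantor.cancel_of_to.
  - intros x y [l [Hl Hx]] [e [He Hlim]].
    assert (Hv : forall n N k i, (e n N <= k)%nat ->
      Cmod (value (flatten x (Cantor.to_nat (n, k))) i - value (y n) i) <= / 2 ^ N).
    { intros n N k i Hk; rewrite flatten_to_nat, <- value_minus.
      eapply Rle_trans; [apply Cmod_value_le|exact (Hlim n N k Hk)]. }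
    (* The list of the double sequence also serves the limit: off [l], each limit value is within
       2^-N of 0 for every N. *)
    exists l; split.
    + intros n i Hi; apply Cmod_eq_0; apply Rle_antisym; [|apply Cmod_ge_0].
      apply Rnot_lt_le; intros Hpos.
      destruct (pow_lt_1_zero (/ 2)) with (y := Cmod (value (y n) i))
        as [N HN]; [rewrite Rabs_pos_eq; lra|exact Hpos|].
      specialize (HN N (le_n _)); specialize (Hv n N _ i (le_n _)).
      rewrite (Hl _ _ Hi) in Hv.
      replace (0 - value (y n) i)%C with (- value (y n) i)%C in Hv by ring.
      rewrite Cmod_opp in Hv; rewrite pow_inv in HN.
      rewrite Rabs_pos_eq in HN by (apply Rlt_le, Rinv_0_lt_compat, pow2_pos).
      lra.
    + intros i; destruct (Hx i) as [HRe HIm]; split.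
      * apply (computable_limit _ He HRe); intros n N k Hk.
        eapply Rle_trans; [|exact (Hv n N k i Hk)].
        eapply Rle_trans; [|apply re_le_Cmod]; apply Req_le; reflexivity.
      * apply (computable_limit _ He HIm); intros n N k Hk.
        eapply Rle_trans; [|exact (Hv n N k i Hk)].
        eapply Rle_trans; [|apply Rmax_Cmod].
        eapply Rle_trans; [|apply Rmax_r]; apply Req_le; reflexivity.
  - intros x [l [Hl Hx]].
    apply computable_real_seq_ext with (x := fun n =>
      fold_right (fun i r => Rmax (Cmod (value (x n) i)) r) 0 l).
    + intros n; symmetry; apply norm_finite_support, Hl.
    + clear Hl; induction l as [|i l IH]; [exact (computable_const 0)|].
      exact (computable_max (computable_Cmod (Hx i)) IH).
Qed.

(** * Unit vectors *)

Definition indicator (i j : I) : C :=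
  if excluded_middle_informative (i = j) then RtoC 1 else RtoC 0.

Lemma indicator_bounded (i : I) : bounded C_NormedModule (indicator i).
Proof.
  exists 1; intros j; unfold indicator.
  change (Cmod (if excluded_middle_informative (i = j) then RtoC 1 else RtoC 0) <= 1).
  destruct (excluded_middle_informative _); [rewrite Cmod_1|rewrite Cmod_0]; lra.
Qed.

Definition unit_vector (i : I) : bfunC := exist _ _ (indicator_bounded i).

Lemma unit_vector_inj (i j : I) : unit_vector i = unit_vector j -> i = j.
Proof.
  intros H; assert (E : indicator i i = indicator j i)
    by exact (f_equal (fun x => value x i) H).
  unfold indicator in E.
  destruct (excluded_middle_informative (i = i)) as [_|n]; [|easy].
  destruct (excluded_middle_informative (j = i)) as [e|_]; [easy|].
  apply RtoC_inj in E; lra.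
Qed.

(** Every coordinate is constantly 0 or 1. The undecidable test [i = j] only selects which constant
    algorithm applies; no algorithm evaluates it. *)
Lemma unit_vector_computable (i : I) :
  computable_element bfunC fs_computable (unit_vector i).
Proof.
  exists (i :: nil); split.
  - intros _ j Hj; change (indicator i j = 0%C); unfold indicator.
    destruct (excluded_middle_informative (i = j)) as [e|_]; [|easy].
    destruct Hj; now left.
  - intros j; change (computable_complex_seq (fun _ => indicator i j)).
    unfold indicator; destruct (excluded_middle_informative (i = j)).
    + exact (computable_complex_const 1).
    + exact (computable_complex_const 0).
Qed.

End FinitelySupported.

(** * Uncountability *)

(** Cantor's diagonal set, phrased for injections: D collects the codes of sets that do not contain
    their own code. Injectivity makes D the only set with code [F D], so [F D] belongs to D exactly
    when it does not. *)
Lemma powerset_not_countable (F : (nat -> Prop) -> nat) :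
  ~ (forall A B, F A = F B -> A = B).
Proof.
  intros Hinj.
  set (D := fun n => exists A, F A = n /\ ~ A n).
  assert (HD : ~ D (F D)).
  { intros H; pose proof H as H'; destruct H' as [A [HA HnA]].
    apply Hinj in HA; subst A; easy. }
  apply HD; now exists D.
Qed.

Theorem theorem47 :
  exists (X : CompleteNormedModule C_AbsRing) (CS : (nat -> X) -> Prop),
    computability_structure X CS /\ ~ countable (computable_element X CS).
Proof.
  exists (bfunC (nat -> Prop)), (@fs_computable (nat -> Prop)).
  split; [apply fs_computable_structure|].
  intros [f Hf].
  (* With sets of naturals as indices, an injection of the computable elements into [nat] would
     restrict to one of the power set. *)
  apply (powerset_not_countable (fun A => f (unit_vector A))).
  intros A B HAB; apply unit_vector_inj, Hf; [| |exact HAB];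
    apply unit_vector_computable.
Qed.
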